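(* Let $\mathcal{C}_{\max}$ be the maximum element-wise curvature of $f(S)=\mathrm{Tr}(\mathbf{P}-\mathbf{F}_S^{-1})$. Let $S_k$ denote the subset of sensors selected by the randomized greedy algorithm at time $k$, and let $O_k$ be the optimum solution, with $|O_k|=K$, of $$\max_{S}\ f(S)\quad\text{s.t. } S\subset[n],\ |S|=K.$$ Then $f(S_k)$ is in expectation a multiplicative factor away from $f(O_k)$; that is, $$\mathbb{E}[f(S_k)]\ge\left(1-e^{-\frac1c}-\frac{\epsilon^\beta}{c}\right)f(O_k),$$ where $c=\max\{\mathcal{C}_{\max},1\}$, $e^{-K}\le\epsilon<1$, and $\beta=1+\max\left\{0,\frac{s}{2n}-\frac{1}{2(n-s)}\right\}$ with $s=\frac nK\log(1/\epsilon)$. Furthermore, the computational complexity of the randomized greedy algorithm is $\mathcal{O}\left(nm^2\log\frac1\epsilon\right)$, where $n$ is the total number of sensors and $m$ is the dimension of the state vector.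
   Context: Let $[n]=\{1,\dots,n\}$ index the sensors. At a fixed time step $k$ one is given a symmetric positive definite $\mathbf{P}\in\mathbb{R}^{m\times m}$ (the Kalman filter's predicted error covariance $\mathbf{P}_{k|k-1}$ of the $m$-dimensional state), measurement (column) vectors $\mathbf{h}_1,\dots,\mathbf{h}_n\in\mathbb{R}^m$, and noise variances $\sigma_1^2,\dots,\sigma_n^2>0$. For $S\subseteq[n]$, $$\mathbf{F}_S=\mathbf{P}^{-1}+\sum_{i\in S}\sigma_i^{-2}\mathbf{h}_i\mathbf{h}_i^\top,\qquad f(S)=\mathrm{Tr}(\mathbf{P}-\mathbf{F}_S^{-1}),\qquad f_i(S)=f(S\cup\{i\})-f(S).$$ Element-wise curvature: $$\mathcal{C}_l=\max_{(S,T,i)\in\mathcal{X}_l}\frac{f_i(T)}{f_i(S)},\qquad \mathcal{X}_l=\{(S,T,i): S\subset T\subset[n],\ i\in[n]\setminus T,\ |T\setminus S|=l\},$$ and $\mathcal{C}_{\max}=\max_l\mathcal{C}_l$. Randomized greedy algorithm (inputs $\mathbf{P}$, the $\mathbf{h}_j$, $K$, $\epsilon$): start with $S_k^{(0)}=\emptyset$ and $\mathbf{F}^{-1}_{S_k^{(0)}}=\mathbf{P}$. For $i=0,\dots,K-1$: choose $R$ by sampling $s=\frac nK\log(1/\epsilon)$ indices uniformly at random, without replacement, from $[n]\setminus S_k^{(i)}$ (for $\epsilon=e^{-K}$, $R$ consists of all non-selected sensors); let $$i_s=\arg\max_{j\in R}\frac{\mathbf{h}_j^\top\mathbf{F}_{S_k^{(i)}}^{-2}\mathbf{h}_j}{\sigma_j^2+\mathbf{h}_j^\top\mathbf{F}_{S_k^{(i)}}^{-1}\mathbf{h}_j}$$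 (the quantity maximized equals $f_j(S_k^{(i)})$); set $S_k^{(i+1)}=S_k^{(i)}\cup\{i_s\}$ and $$\mathbf{F}^{-1}_{S_k^{(i+1)}}=\mathbf{F}_{S_k^{(i)}}^{-1}-\frac{\mathbf{F}_{S_k^{(i)}}^{-1}\mathbf{h}_{i_s}\mathbf{h}_{i_s}^\top\mathbf{F}_{S_k^{(i)}}^{-1}}{\sigma_{i_s}^2+\mathbf{h}_{i_s}^\top\mathbf{F}_{S_k^{(i)}}^{-1}\mathbf{h}_{i_s}} .$$ Output $S_k=S_k^{(K)}$. The expectation is over the randomness of the algorithm.
   Formalization: The complexity bound is shown for s ≥ s0 with a constant depending only on s0 > 0, as it fails uniformly when ε → 1 (each iteration samples at least one sensor); m ≥ 1 there; the sample size is s rounded up, capped by the remaining sensors, and β = 1 at s = n. *)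

(* Defs.v *)
From mathcomp Require Import all_boot all_order all_algebra.
From mathcomp Require Import reals sequences exp.

Set Implicit Arguments.
Unset Strict Implicit.
Unset Printing Implicit Defensive.

Import Order.TTheory GRing.Theory Num.Theory.
Local Open Scope ring_scope.

Definition spd (R : realType) m (P : 'M[R]_m) :=
  P^T = P /\ forall x : 'cV[R]_m, x != 0 -> 0 < (x^T *m P *m x) 0 0.

(* [var i] is the noise variance, i.e. the square of sigma_i. *)
Definition fisher (R : realType) m n (P : 'M[R]_m) (h : 'I_n -> 'cV[R]_m)
    (var : 'I_n -> R) (S : {set 'I_n}) : 'M[R]_m :=
  invmx P + \sum_(i in S) (var i)^-1 *: (h i *m (h i)^T).

Definition objective (R : realType) m n (P : 'M[R]_m) (h : 'I_n -> 'cV[R]_m)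
    (var : 'I_n -> R) (S : {set 'I_n}) : R :=
  \tr (P - invmx (fisher P h var S)).

Definition is_optimum (R : realType) n (f : {set 'I_n} -> R) (K : nat)
    (O : {set 'I_n}) :=
  #|O| = K /\ forall S : {set 'I_n}, #|S| = K -> f S <= f O.

Definition marginal (R : realType) n (f : {set 'I_n} -> R) (i : 'I_n)
    (S : {set 'I_n}) : R :=
  f (i |: S) - f S.

Definition curvature_dom n (l : nat) : {set {set 'I_n} * {set 'I_n} * 'I_n} :=
  [set x : {set 'I_n} * {set 'I_n} * 'I_n |
           let: (S0, T, i) := x in
           [&& S0 \subset T, i \notin T & #|T :\: S0| == l]].

(* The base value 0 is harmless: [objective] is monotone, so the ratios are
   nonnegative.  A ratio whose denominator vanishes (which happens only for
   h_i = 0, and then it reads 0 / 0) counts as 0. *)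
Definition curvature (R : realType) n (f : {set 'I_n} -> R) (l : nat) : R :=
  \big[Num.max/0]_(x in curvature_dom n l)
    (let: (S0, T, i) := x in marginal f i T / marginal f i S0).

(* [curvature_dom n l] is empty for l >= n. *)
Definition max_curvature (R : realType) n (f : {set 'I_n} -> R) : R :=
  \big[Num.max/0]_(1 <= l < n) curvature f l.

Definition sample_param (R : realType) (n K : nat) (eps : R) : R :=
  n%:R / K%:R * ln (eps^-1).

(* At s = n (that is, eps = exp (- K)) the term 1 / (2 (n - s)) is +oo, so the
   maximum is 0; the case is separated because x / 0 = 0 in MathComp. *)
Definition beta_exp (R : realType) (n : nat) (s : R) : R :=
  1 + (if s == n%:R then 0
       else Num.max 0 (s / (2 * n%:R) - (2 * (n%:R - s))^-1)).

(* The possible samples once S has been selected: the subsets of the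
   complement of S whose size is s rounded up to an integer, capped by the
   number of remaining sensors. *)
Definition samples (R : realType) n (s : R) (S : {set 'I_n}) :
    {set {set 'I_n}} :=
  [set A : {set 'I_n} |
     (A \subset ~: S) && (#|A| == minn `|Num.ceil s|%N #|~: S|)].

(* [timed A] pairs a result with the number of elementary operations spent.
   An elementary operation is one arithmetic operation or comparison of
   scalars, the drawing of one index, or the insertion of one index in a set;
   matrix entries are read and stored for free. *)

Definition timed (A : Type) : Type := (A * nat)%type.
Definition value A (c : timed A) : A := c.1.
Definition cost A (c : timed A) : nat := c.2.

Definition ret A (a : A) : timed A := (a, 0%N).
Definition op A (a : A) : timed A := (a, 1%N).
Definition bind A B (c : timed A) (k : A -> timed B) : timed B :=
  (value (k (value c)), (cost c + cost (k (value c)))%N).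

Notation "'do' x <- c ; k" := (bind c (fun x => k))
  (at level 200, x name, c at level 100, k at level 200,
   format "'[v' 'do'  x  <-  c ; '/' k ']'").

Fixpoint tfold A B (step : B -> A -> timed B) (b : B) (s : seq A) : timed B :=
  if s is a :: s' then do b' <- step b a; tfold step b' s' else ret b.

Definition tcol (R : realType) m (F : 'I_m -> timed R) : timed 'cV[R]_m :=
  (\col_i value (F i), (\sum_i cost (F i))%N).

Definition tmx (R : realType) m (F : 'I_m -> 'I_m -> timed R) :
    timed 'M[R]_m :=
  (\matrix_(i, j) value (F i j), (\sum_i \sum_j cost (F i j))%N).

Definition dot (R : realType) m (x y : 'I_m -> R) : timed R :=
  tfold (fun acc k => do p <- op (x k * y k); op (acc + p)) 0 (enum 'I_m).

Definition matvec (R : realType) m (M : 'M[R]_m) (x : 'cV[R]_m) :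
    timed 'cV[R]_m :=
  tcol (fun i => dot (M i) (fun k => x k 0)).

Definition score (R : realType) m (M : 'M[R]_m) (h : 'cV[R]_m) (v : R) :
    timed R :=
  do y <- matvec M h;
  do z <- matvec M y;
  do num <- dot (fun k => h k 0) (fun k => z k 0);
  do q <- dot (fun k => h k 0) (fun k => y k 0);
  do den <- op (v + q);
  op (num / den).

Definition update (R : realType) m (M : 'M[R]_m) (h : 'cV[R]_m) (v : R) :
    timed 'M[R]_m :=
  do y <- matvec M h;
  do z <- matvec M^T h;
  do q <- dot (fun k => h k 0) (fun k => y k 0);
  do den <- op (v + q);
  tmx (fun i j =>
    do p <- op (y i 0 * z j 0);
    do t <- op (p / den);
    op (M i j - t)).

(* Linear scan for a maximizer; on ties the first one examined is kept. *)
Definition scan_step (R : realType) n (g : 'I_n -> timed R)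
    (best : option ('I_n * R)) (j : 'I_n) : timed (option ('I_n * R)) :=
  do x <- g j;
  if best is Some b
  then do lt <- op (b.2 < x); ret (Some (if lt then (j, x) else b))
  else ret (Some (j, x)).

Definition scan (R : realType) n (g : 'I_n -> timed R) (r : seq 'I_n) :
    timed (option ('I_n * R)) :=
  tfold (scan_step g) None r.

Definition draw n (r : seq 'I_n) : timed (seq 'I_n) := (r, size r).

(* A state is the set selected so far with the current inverse of F. *)
Definition state (R : realType) m n : Type := ({set 'I_n} * 'M[R]_m)%type.

Definition init_state (R : realType) m n (P : 'M[R]_m) : state R m n :=
  (set0, P).

(* [ord S A] lists the elements of the sample A in the order in which they are
   examined when S is the current selection; as it is arbitrary, so is the way
   ties are broken in the argmax.  The [None] branch is only taken when the
   sample is empty. *)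
Definition greedy_step (R : realType) m n (h : 'I_n -> 'cV[R]_m)
    (var : 'I_n -> R) (ord : {set 'I_n} -> {set 'I_n} -> seq 'I_n)
    (st : state R m n) (A : {set 'I_n}) : timed (state R m n) :=
  do r <- draw (ord st.1 A);
  do best <- scan (fun j => score st.2 (h j) (var j)) r;
  if best is Some b then
    do S <- op (b.1 |: st.1);
    do M <- update st.2 (h b.1) (var b.1);
    ret (S, M)
  else ret st.

(* Execution in which the successive samples are those listed in [As]. *)
Definition greedy (R : realType) m n (P : 'M[R]_m) (h : 'I_n -> 'cV[R]_m)
    (var : 'I_n -> R) (ord : {set 'I_n} -> {set 'I_n} -> seq 'I_n)
    (As : seq {set 'I_n}) : timed (state R m n) :=
  tfold (greedy_step h var ord) (init_state n P) As.

Definition greedy_set (R : realType) m n (P : 'M[R]_m)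
    (h : 'I_n -> 'cV[R]_m) (var : 'I_n -> R)
    (ord : {set 'I_n} -> {set 'I_n} -> seq 'I_n) (As : seq {set 'I_n}) :
    {set 'I_n} :=
  (value (greedy P h var ord As)).1.

(* Probability that, from the state [st], the successive samples are those
   listed in [As]: each one is uniform over [samples s S], given the past. *)
Fixpoint samples_prob (R : realType) m n (h : 'I_n -> 'cV[R]_m)
    (var : 'I_n -> R) (ord : {set 'I_n} -> {set 'I_n} -> seq 'I_n) (s : R)
    (st : state R m n) (As : seq {set 'I_n}) : R :=
  if As is A :: As' then
    (if A \in samples s st.1 then #|samples s st.1|%:R^-1 else 0)
    * samples_prob h var ord s (value (greedy_step h var ord st A)) As'
  else 1.

Definition run_prob (R : realType) m n (P : 'M[R]_m) (h : 'I_n -> 'cV[R]_m)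
    (var : 'I_n -> R) (ord : {set 'I_n} -> {set 'I_n} -> seq 'I_n) (s : R)
    (As : seq {set 'I_n}) : R :=
  samples_prob h var ord s (init_state n P) As.

Definition greedy_expectation (R : realType) m n (P : 'M[R]_m)
    (h : 'I_n -> 'cV[R]_m) (var : 'I_n -> R)
    (ord : {set 'I_n} -> {set 'I_n} -> seq 'I_n) (s : R) (K : nat)
    (X : {set 'I_n} -> R) : R :=
  \sum_(As : K.-tuple {set 'I_n})
    run_prob P h var ord s As * X (greedy_set P h var ord As).

Local Lemma value_bind A B (c : timed A) (k : A -> timed B) :
  value (bind c k) = value (k (value c)).
Proof. by []. Qed.

Local Lemma value_op A (a : A) : value (op a) = a.
Proof. by []. Qed.

Lemma dotE (R : realType) m (x y : 'I_m -> R) :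
  value (dot x y) = \sum_k x k * y k.
Proof.
have aux r a : value (tfold (fun acc k => do p <- op (x k * y k); op (acc + p))
    a r) = a + \sum_(k <- r) x k * y k.
  elim: r a => [|k r IHr] a /=; first by rewrite big_nil addr0.
  by rewrite big_cons addrA -IHr.
by rewrite /dot aux add0r big_enum.
Qed.

Lemma matvecE (R : realType) m (M : 'M[R]_m) (x : 'cV[R]_m) :
  value (matvec M x) = M *m x.
Proof. by apply/matrixP => i j; rewrite !mxE dotE (ord1 j). Qed.

Local Lemma dot_mx (R : realType) m (x y : 'cV[R]_m) :
  value (dot (fun k => x k 0) (fun k => y k 0)) = (x^T *m y) 0 0.
Proof. by rewrite dotE mxE; apply: eq_bigr => k _; rewrite mxE. Qed.

Lemma scoreE (R : realType) m (M : 'M[R]_m) (h : 'cV[R]_m) (v : R) :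
  value (score M h v) =
    (h^T *m (M *m M) *m h) 0 0 / (v + (h^T *m M *m h) 0 0).
Proof.
by rewrite /score !(value_bind, value_op) !dot_mx !matvecE !mulmxA.
Qed.

Lemma updateE (R : realType) m (M : 'M[R]_m) (h : 'cV[R]_m) (v : R) :
  value (update M h v) =
    M - (v + (h^T *m M *m h) 0 0)^-1 *: (M *m h *m h^T *m M).
Proof.
rewrite /update !value_bind; apply/matrixP => i j.
rewrite mxE !(value_bind, value_op) dot_mx !matvecE mulmxA.
rewrite [RHS]mxE; congr (_ + _); rewrite [RHS]mxE; congr (- _).
rewrite [RHS]mxE mulrC; congr (_ * _).
rewrite -(mulmxA _ h^T) [RHS]mxE big_ord1; congr (_ * _).
by rewrite !mxE; apply: eq_bigr => k _; rewrite !mxE mulrC.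
Qed.

Lemma scanP (R : realType) n (g : 'I_n -> timed R) (r : seq 'I_n) :
  r != [::] ->
  exists2 j, value (scan g r) = Some (j, value (g j)) &
    j \in r /\ {in r, forall k, value (g k) <= value (g j)}.
Proof.
case: r => // i r _; rewrite /scan /=.
elim: r i => [|k r IHr] i /=.
  by exists i => //; split=> [|k]; rewrite inE => // /eqP ->.
have [lt_ik|le_ki] := ltP (value (g i)) (value (g k)).
- have [j -> [jr jmax]] := IHr k; exists j => //; split.
    by rewrite inE jr orbT.
  move=> l; rewrite inE => /predU1P[->|/jmax //].
  by rewrite (le_trans (ltW lt_ik)) // jmax ?mem_head.
- have [j -> [jr jmax]] := IHr i; exists j => //; split.
    by move: jr; rewrite !inE => /orP[->|->]; rewrite ?orbT.
  move=> l; rewrite !inE => /or3P[/eqP->|/eqP->|lr].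
  + by rewrite jmax ?mem_head.
  + by rewrite (le_trans le_ki) // jmax ?mem_head.
  + by rewrite jmax // inE lr orbT.
Qed.

Lemma card_samples_gt0 (R : realType) n (s : R) (S0 : {set 'I_n}) :
  (0 < #|samples s S0|)%N.
Proof.
by rewrite /samples cards_draws bin_gt0 geq_minr.
Qed.

Lemma samples_prob_ge0 (R : realType) m n (h : 'I_n -> 'cV[R]_m)
    (var : 'I_n -> R) (ord : {set 'I_n} -> {set 'I_n} -> seq 'I_n) (s : R)
    (st : state R m n) (As : seq {set 'I_n}) :
  0 <= samples_prob h var ord s st As.
Proof.
elim: As st => //= A As IHAs st; rewrite mulr_ge0 //.
by case: ifP => // _; rewrite invr_ge0.
Qed.

Lemma sum_samples_prob (R : realType) m n (h : 'I_n -> 'cV[R]_m)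
    (var : 'I_n -> R) (ord : {set 'I_n} -> {set 'I_n} -> seq 'I_n) (s : R)
    (K : nat) (st : state R m n) :
  \sum_(As : K.-tuple {set 'I_n}) samples_prob h var ord s st As = 1.
Proof.
elim: K st => [|K IHK] st.
  rewrite (big_pred1 [tuple]) // => As; first by rewrite (tuple0 As).
pose F (x : {set 'I_n} * K.-tuple {set 'I_n}) := [tuple of x.1 :: x.2].
rewrite (reindex F) /=; last first.
  exists (fun As => (thead As, [tuple of behead As])) => [[A As] _|As _].
    by rewrite /F /=; congr (_, _); apply: val_inj.
  by rewrite /F /= [RHS]tuple_eta; apply: val_inj.
rewrite -(pair_bigA _ (fun A (As : K.-tuple _) =>
  samples_prob h var ord s st (A :: As))) /=.
under eq_bigr => A _ do rewrite -mulr_sumr IHK mulr1.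
rewrite -big_mkcond sumr_const -[LHS]mulr_natl divff //.
by rewrite pnatr_eq0 -lt0n card_samples_gt0.
Qed.

(* Main.v *)
Require Import Defs.
From mathcomp Require Import all_boot all_order all_algebra perm.
From mathcomp Require Import ring lra zify.
From mathcomp Require Import topology normedtype derive.
From mathcomp Require Import reals sequences exp.

(* Let S be the current selection, W = O \ S and r = #|W|. The sample misses W
   with probability at most exp (- r (1/n + 1/(n-1) + ... + 1/(n-s+1))), which a
   comparison of this harmonic sum with a logarithm bounds by
   (eps ^ beta) ^ (r / K).  When it does not miss W, the greedy gain dominates
   the average of the gains of the sampled elements of W, and by symmetry all
   the elements of W weigh the same in that average; since
   1 - x ^ r >= (r / K) (1 - x ^ K) for x in [0, 1], the expected gain is at least
   (1 - eps ^ beta) / K times the sum of the gains over W.  By telescoping and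
   the definition of the curvature that sum is at least (f O - f S) / c, so
   every step shrinks f O - E f(S) by the factor 1 - (1 - eps ^ beta) / (c K). *)

Set Implicit Arguments.
Unset Strict Implicit.
Unset Printing Implicit Defensive.

Import Order.TTheory GRing.Theory Num.Theory.
Import numFieldNormedType.Exports.
Local Open Scope ring_scope.

(** * Exponential and harmonic estimates *)

Lemma is_derive_ge0_le (R : realType) (f g : R -> R) (x : R) :
  (forall y : R, is_derive y 1 f (g y)) -> (forall y, 0 <= y -> 0 <= g y) ->
  0 <= x -> f 0 <= f x.
Proof.
move=> df g0 x0; have dfy y : derivable f y 1 by have [] := df y.
apply: (@ger0_derive1_le_cc _ f 0 x) => //; rewrite ?in_itv /= ?lexx ?x0 //.
- move=> y; rewrite in_itv /= => /andP[y0 _].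
  by rewrite derive1E (@derive_val _ _ _ _ _ _ _ (df y)) g0 // ltW.
- by apply: derivable_within_continuous => y _.
Qed.

(** The difference vanishes at 0 and its derivative, [expR z + expR (- z) - 2], is the square of
    [expR (z / 2) - expR (- (z / 2))]. *)
Lemma sinh_ge (R : realType) (y : R) : 0 <= y -> 2 * y <= expR y - expR (- y).
Proof.
move=> y0; rewrite -subr_ge0.
pose f (z : R) : R := expR z - expR (- z) - 2 * z.
pose g (z : R) : R := expR z + expR (- z) - 2.
have -> : 0 = f 0 by rewrite /f oppr0 expR0; ring.
apply: (@is_derive_ge0_le _ f g) => // z; last first.
  have -> : g z = (expR (z / 2) - expR (- (z / 2))) ^+ 2.
    rewrite /g [z in LHS](_ : z = z / 2 + z / 2); last by field.
    rewrite opprD !expRD sqrrB -!expr2 -expRD subrr expR0; ring.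
  by move=> _; apply: sqr_ge0.
rewrite /f /g; apply: is_derive_eq.
rewrite /GRing.scale /=; ring.
Qed.

(** The substitution [u = 1 - expR (- w)] turns the logarithm into [w]; the difference of the two
    sides, as a function of [w], then has derivative [(1 - expR (- w)) ^+ 2]. *)
Lemma ln_onem_le (R : realType) (u : R) :
  0 <= u < 1 -> u + u ^+ 2 / 2 <= - ln (1 - u).
Proof.
move=> /andP[u0 u1].
pose w := - ln (1 - u).
have w0 : 0 <= w by rewrite oppr_ge0 ln_le0 // gerBl.
have uE : u = 1 - expR (- w) by rewrite opprK lnK ?posrE ?subr_gt0 //; ring.
rewrite -/w uE -subr_ge0; clearbody w; clear u uE u0 u1.
pose f (z : R) : R := z - (1 - expR (- z)) - (1 - expR (- z)) * (1 - expR (- z)) / 2.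
have -> : 0 = f 0 by rewrite /f oppr0 expR0; ring.
rewrite opprD addrA expr2.
apply: (@is_derive_ge0_le _ f (fun z => (1 - expR (- z)) ^+ 2)) => // z; last first.
  by move=> _; apply: sqr_ge0.
rewrite /f; apply: is_derive_eq.
by rewrite /GRing.scale /=; field.
Qed.

(** This is [sinh_ge] at [y = ln ((k + 1) / k)], because [(k + 1) / k - k / (k + 1)] equals
    [1 / k + 1 / (k + 1)]. It serves as the trapezoidal rule on one unit interval. *)
Lemma ln_succ_div_le (R : realType) (k : R) :
  0 < k -> ln ((k + 1) / k) <= ((k + 1)^-1 + k^-1) / 2.
Proof.
move=> k0; have k1 : 0 < k + 1 by rewrite addr_gt0.
have a0 : 0 < (k + 1) / k by rewrite divr_gt0.
have /sinh_ge : 0 <= ln ((k + 1) / k).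
  by rewrite ln_ge0 // ler_pdivlMr // mul1r lerDl.
rewrite expRN lnK ?posrE // => le2.
rewrite -(ler_pM2l (_ : 0 < 2)) //; apply: le_trans le2 _.
rewrite le_eqVlt; apply/orP; left; apply/eqP; field.
by rewrite !gt_eqF.
Qed.

(* Trapezoidal rule for the convex function 1 / x on [n - t, n]. *)
Lemma sum_inv_ge_ln (R : realType) (n t : nat) : (t < n)%N ->
  ln (n%:R / (n - t)%:R) - ((n - t)%:R^-1 - n%:R^-1) / 2
    <= \sum_(l < t) (n - l)%:R^-1 :> R.
Proof.
elim: t => [|t IHt] tn.
  rewrite big_ord0 subn0 divff ?ln1 ?subrr ?mul0r ?subr0 //.
  by rewrite pnatr_eq0 -lt0n.
rewrite big_ord_recr /=; have {}IHt := IHt (ltnW tn).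
have k0 : (0 < (n - t.+1)%:R :> R) by rewrite ltr0n subn_gt0.
have n0 : (0 < n%:R :> R) by rewrite ltr0n; lia.
have kE : (n - t)%:R = (n - t.+1)%:R + 1 :> R by rewrite natr1; congr _%:R; lia.
have := ln_succ_div_le k0; rewrite -kE => lek.
have nt0 : (0 < (n - t)%:R :> R) by rewrite kE addr_gt0.
rewrite (_ : n%:R / (n - t.+1)%:R = (n%:R / (n - t)%:R) * ((n - t)%:R / (n - t.+1)%:R) :> R);
  last by field; rewrite !gt_eqF.
rewrite lnM ?posrE ?divr_gt0 //; lra.
Qed.

(* When the maximum in [beta_exp] is not 0, s (n - s) >= n, so that n - s >= 1;
   past this point ln (n / (n - x)) - 1 / (2 (n - x)) is still increasing in x,
   which is why rounding s up to t does no harm. *)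
Lemma beta_exp_le_sum_inv (R : realType) (n t : nat) (s : R) :
  0 < s <= n%:R -> s <= t%:R < s + 1 -> (t <= n)%N ->
  beta_exp n s * s / n%:R <= \sum_(l < t) (n - l)%:R^-1.
Proof.
move=> /andP[s0 sn] /andP[st ts] tn.
have n0 : 0 < n%:R :> R by apply: lt_le_trans sn.
(* Each of the [t >= s] terms is at least [1 / n]; this settles the cases where [beta_exp n s] is
   1. *)
have base : s / n%:R <= \sum_(l < t) (n - l)%:R^-1 :> R.
  apply: (@le_trans _ _ (\sum_(l < t) n%:R^-1)); last first.
    apply: ler_sum => l _; rewrite lef_pV2 ?posrE ?ltr0n ?ler_nat;
      have := ltn_ord l; lia.
  by rewrite sumr_const card_ord -[leRHS]mulr_natl ler_pM2r ?invr_gt0.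
rewrite /beta_exp; case: eqP => [_|/eqP sneq]; first by rewrite addr0 mul1r.
rewrite maxEle; case: ifP => [x0|_]; last by rewrite addr0 mul1r.
have sn' : s < n%:R by rewrite lt_neqAle sneq.
have ns0 : 0 < n%:R - s by rewrite subr_gt0.
have sns : n%:R <= s * (n%:R - s).
  have := x0; rewrite subr_ge0 -subr_ge0.
  rewrite (_ : _ - _ = (s * (n%:R - s) - n%:R) / (2 * n%:R * (n%:R - s))); last first.
    by field; rewrite !gt_eqF.
  by rewrite pmulr_lge0 ?subr_ge0 // invr_gt0 !mulr_gt0.
have tltn : (t < n)%N.
  rewrite -(ltr_nat R); apply: lt_le_trans ts _.
  have : n%:R * 1 <= n%:R * (n%:R - s) by rewrite mulr1 (le_trans sns) // ler_pM2r // ltW.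
  by rewrite ler_pM2l //; lra.
apply: le_trans (sum_inv_ge_ln R tltn).
rewrite natrB //; have nt1 : 1 <= n%:R - t%:R :> R by rewrite -natrB // ler1n subn_gt0.
have nt0 : 0 < n%:R - t%:R :> R by apply: lt_le_trans nt1.
set N := n%:R in n0 sn sn' ns0 sns nt1 nt0 *; set T := t%:R in st ts nt1 nt0 *.
have u01 : 0 <= s / N < 1 by rewrite divr_ge0 ?(ltW s0) ?(ltW n0) //= ltr_pdivrMr // mul1r.
have l1 := ln_onem_le u01.
(* Rounding s up to t increases the logarithm by at least the left-hand side, and [l3] shows that
   this covers the increase of the trapezoidal correction. *)
have l2 : 1 - (N - T) / (N - s) <= ln ((N - s) / (N - T)).
  have : ln (1 + ((N - T) / (N - s) - 1)) <= (N - T) / (N - s) - 1.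
    by apply: le_ln1Dx; rewrite ltrBrDl subrr divr_gt0.
  rewrite addrC subrK -(invf_div (N - s)) lnV ?posrE ?divr_gt0 //; lra.
have l3 : ((N - T)^-1 - (N - s)^-1) / 2 <= 1 - (N - T) / (N - s).
  rewrite -subr_ge0.
  rewrite (_ : _ - _ = (T - s) * (2 * (N - T) - 1) / (2 * (N - T) * (N - s))); last first.
    by field; rewrite !gt_eqF.
  rewrite divr_ge0 ?mulr_ge0 ?subr_ge0 //; lra.
have l4 : ln (N / (N - T)) = - ln (1 - s / N) + ln ((N - s) / (N - T)).
  rewrite -lnV ?posrE ?subr_gt0; last by case/andP: u01.
  rewrite -lnM ?posrE ?invr_gt0 ?subr_gt0 ?divr_gt0 //; last by case/andP: u01.
  by congr ln; field; rewrite !gt_eqF.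
rewrite l4.
(* The exponent is exactly the second-order lower bound [l1] of the logarithm at s, minus the
   trapezoidal correction at s. *)
have -> : (1 + (s / (2 * N) - (2 * (N - s))^-1)) * s / N =
  (s / N + (s / N) ^+ 2 / 2) - ((N - s)^-1 - N^-1) / 2 by field; rewrite !gt_eqF.
lra.
Qed.

(** Raising t by one multiplies the quotient of the binomials by [1 - r / (N - t)], which is at most
    [expR (- (r / (N - t)))]. *)
Lemma bin_subn_le_expR (R : realType) (N r t : nat) : (t <= N)%N ->
  'C(N - r, t)%:R <= 'C(N, t)%:R * expR (- (r%:R * \sum_(l < t) (N - l)%:R^-1)) :> R.
Proof.
elim: t => [|t IHt] tN; first by rewrite !bin0 big_ord0 mulr0 oppr0 expR0 mulr1.
have t0 : 0 < t.+1%:R :> R by rewrite ltr0n.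
rewrite -(ler_pM2l t0) mulrA -!natrM !mul_bin_left !natrM big_ord_recr /=.
rewrite mulrDr opprD expRD.
have nt : 0 < (N - t)%:R :> R by rewrite ltr0n subn_gt0.
have step : (N - r - t)%:R <= (N - t)%:R * expR (- (r%:R / (N - t)%:R)) :> R.
  (* Past [r + t = N] the subtraction is truncated to 0 and the bound is trivial. *)
  have [rN|rN] := leqP (r + t) N; last first.
    rewrite (_ : (N - r - t)%N = 0%N); last by lia.
    by rewrite mulr_ge0 // expR_ge0.
  apply: le_trans (ler_wpM2l (ltW nt) (expR_ge1Dx _)).
  rewrite mulrDr mulr1 mulrN mulrC divfK ?gt_eqF //.
  by rewrite -natrB; [rewrite ler_nat; lia | lia].
have := ler_pM (ler0n _ _) (ler0n _ _) step (IHt (ltnW tN)).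
by move/le_trans; apply; rewrite le_eqVlt; apply/orP; left; apply/eqP; ring.
Qed.

(* The ratio of the two binomials is the probability that a uniform sample
   misses r given elements out of N. *)
Lemma bin_subn_le_expR_beta (R : realType) (n N r t : nat) (s : R) :
  (N <= n)%N -> (r <= N)%N ->
  0 < s <= n%:R -> s <= t%:R < s + 1 ->
  'C(N - r, minn t N)%:R
    <= 'C(N, minn t N)%:R * expR (- (beta_exp n s * s / n%:R)) ^+ r.
Proof.
move=> Nn rN s0n st; rewrite -expRM_natl.
(* For [N <= t] the sample consists of all N elements, so it misses r of them only if [r = 0]. *)
have [Nt|tN] := leqP N t.
  case: r rN => [|r] rN; first by rewrite subn0 mul0r expR0 mulr1.
  by rewrite bin_small; [rewrite mulr_ge0 // expR_ge0 | lia].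
apply: le_trans (bin_subn_le_expR R r (ltnW tN)) _.
rewrite ler_wpM2l // ler_expR mulrN lerN2 ler_wpM2l //.
(* The estimate is known for n; replacing n by [N <= n] only increases the terms of the harmonic
   sum. *)
apply: le_trans (beta_exp_le_sum_inv s0n st _) _; first by lia.
apply: ler_sum => l _; rewrite lef_pV2 ?posrE ?ltr0n ?ler_nat; have := ltn_ord l; lia.
Qed.

(** The quotient [(1 - x ^+ r) / r] is [1 - x] times the mean of the first r powers of x, and these
    powers decrease. [aux] says that this mean is at least [x ^+ r]. *)
Lemma onem_expr_ratio (R : realType) (x : R) (r K : nat) :
  0 <= x <= 1 -> (r <= K)%N -> r%:R * (1 - x ^+ K) <= K%:R * (1 - x ^+ r).
Proof.
move=> /andP[x0 x1]; elim: K => [|K IHK]; first by rewrite leqn0 => /eqP->.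
rewrite leq_eqVlt => /predU1P[->//|]; rewrite ltnS => rK.
have xK : x ^+ K <= x ^+ r by apply: ler_wiXn2l.
have aux : r%:R * (x ^+ r * (1 - x)) <= 1 - x ^+ r.
  elim: r {IHK rK xK} => [|r IHr]; first by rewrite expr0 subrr mul0r.
  have : x * (r%:R * (x ^+ r * (1 - x))) <= x * (1 - x ^+ r) by apply: ler_wpM2l.
  have : x ^+ r * x * (1 - x) <= 1 * (1 - x).
    apply: ler_wpM2r; first by rewrite subr_ge0.
    by rewrite -exprSr exprn_ile1.
  rewrite -(@natr1 _ r) exprSr; nra.
have : r%:R * (x ^+ K * (1 - x)) <= r%:R * (x ^+ r * (1 - x)).
  by apply: ler_wpM2l => //; apply: ler_wpM2r; rewrite // subr_ge0.
have := IHK rK; rewrite -(@natr1 _ K) exprSr; nra.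
Qed.

(** With a the left-hand side, [expR (- c^-1)] is [a * expR (- (x / c))], hence at least
    [a * (1 - x / c)], and [a <= 1]. This separates the contribution of [eps ^ beta] in the final
    bound. *)
Lemma expR_onem_div_le (R : realType) (x c : R) :
  0 <= x <= 1 -> 1 <= c -> expR (- ((1 - x) / c)) <= expR (- c^-1) + x / c.
Proof.
move=> /andP[x0 x1] c1; have c0 : 0 < c by apply: lt_le_trans c1.
set a := expR (- ((1 - x) / c)).
have a0 : 0 < a by apply: expR_gt0.
have -> : expR (- c^-1) = a * expR (- (x / c)).
  by rewrite -expRD; congr expR; field; rewrite gt_eqF.
have xc : 0 <= x / c by rewrite divr_ge0 // ltW.
have a1 : a <= 1.
  by rewrite -expR0 ler_expR oppr_le0 divr_ge0 ?(ltW c0) // subr_ge0.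
have := ler_wpM2l (ltW a0) (expR_ge1Dx (- (x / c))).
nra.
Qed.

Lemma natr_ceil_bound (R : realType) (s : R) :
  0 < s -> s <= `|Num.ceil s|%N%:R < s + 1.
Proof.
move=> s0; have -> : `|Num.ceil s|%N%:R = (Num.ceil s)%:~R :> R.
  by rewrite natr_absz ger0_norm // ceil_ge0 (lt_trans _ s0) // oppr_lt0.
by rewrite ceil_ge /= -ltrBlDr -[1]/(1%:~R) -intrB ceilB1_lt.
Qed.

(** * Uniform samples *)

Definition draws (T : finType) (D : {set T}) (t : nat) : {set {set T}} :=
  [set A : {set T} | (A \subset D) && (#|A| == t)].

(** Double counting: a sample A that meets W is counted once for each element of [A :&: W], with
    weight [1 / #|A :&: W|]. *)
Lemma sum_card_setI_inv (R : numFieldType) (T : finType) (D W : {set T}) (t : nat) :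
  \sum_(w in W) \sum_(A in draws D t | w \in A) #|A :&: W|%:R^-1
    = #|[set A in draws D t | A :&: W != set0]|%:R :> R.
Proof.
rewrite (exchange_big_dep (mem (draws D t))) /=; last by move=> w A _ /andP[].
rewrite -sum1_card natr_sum (bigID (fun A => A :&: W != set0)) /=.
rewrite [X in _ + X]big1 ?addr0 => [|A /andP[AD /negPn/eqP AW]]; last first.
  rewrite big_pred0 // => w; rewrite AD /=; apply/negP => /andP[wW wA].
  by have := in_set0 w; rewrite -AW inE wA wW.
apply: eq_big => [A|A /andP[AD AW]]; first by rewrite [RHS]inE.
rewrite (eq_bigl (fun w => w \in A :&: W)) => [|w]; last by rewrite in_setI AD andbC.
by rewrite sumr_const -[LHS]mulr_natl mulfV // pnatr_eq0 cards_eq0.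
Qed.

(** The transposition of u and v preserves D and W, so it permutes the samples, keeps [#|A :&: W|]
    and exchanges the two membership conditions. *)
Lemma sum_card_setI_inv_tperm (R : numFieldType) (T : finType) (D W : {set T}) (t : nat)
    (u v : T) : W \subset D -> u \in W -> v \in W ->
  \sum_(A in draws D t | u \in A) #|A :&: W|%:R^-1
    = \sum_(A in draws D t | v \in A) #|A :&: W|%:R^-1 :> R.
Proof.
move=> /subsetP WD uW vW.
have im (B : {set T}) : u \in B -> v \in B -> tperm u v @: B = B.
  move=> uB vB; apply: im_perm_on; apply/subsetP => x.
  by rewrite inE; case: tpermP => [->|->|_ _] //; rewrite eqxx.
have mem (A : {set T}) : (u \in tperm u v @: A) = (v \in A).
  by rewrite -{1}(tpermR u v) mem_imset //; apply: perm_inj.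
rewrite (reindex_inj (imset_inj (@perm_inj _ (tperm u v)))) /=.
apply: eq_big => [A|A _]; last first.
  rewrite -{1}(im W uW vW) -imsetI ?card_imset //; first by apply: perm_inj.
  by move=> x y _ _; apply: perm_inj.
rewrite mem; congr (_ && _); rewrite !inE card_imset; last by apply: perm_inj.
congr (_ && _); rewrite -{1}(im D (WD _ uW) (WD _ vW)).
apply/idP/idP => [/subsetP sAD|/imsetS //]; apply/subsetP => x xA.
have := sAD (tperm u v x); rewrite !mem_imset ?xA; [exact | exact: perm_inj..].
Qed.

(* A function [G] of the sample dominating [g] on the sampled elements of [W]
   dominates their average over the sample; by symmetry every element of [W]
   carries the same total weight in these averages. *)
Lemma sum_draws_ge (R : numFieldType) (T : finType) (D W : {set T}) (t : nat)
    (g : T -> R) (G : {set T} -> R) :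
  W \subset D ->
  {in draws D t, forall A, 0 <= G A} ->
  {in draws D t, forall A, {in A :&: W, forall w, g w <= G A}} ->
  ('C(#|D|, t)%:R - 'C(#|D| - #|W|, t)%:R) * \sum_(w in W) g w
    <= #|W|%:R * \sum_(A in draws D t) G A.
Proof.
move=> WD G0 gG.
pose q w : R := \sum_(A in draws D t | w \in A) #|A :&: W|%:R^-1.
have hit : 'C(#|D|, t)%:R - 'C(#|D| - #|W|, t)%:R
    = #|[set A in draws D t | A :&: W != set0]|%:R :> R.
  have -> : (#|D| - #|W| = #|D :\: W|)%N by rewrite cardsD (setIidPr WD).
  rewrite -!cards_draws -[X in X%:R - _](cardsID [set A : {set T} | A :&: W != set0]).
  rewrite natrD [X in _ + X - _](_ : _ = #|[set A : {set T} | A \subset D :\: W & #|A| == t]|%:R).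
    by rewrite addrK; congr _%:R; apply: eq_card => A; rewrite !inE.
  congr _%:R; apply: eq_card => A; rewrite !inE negbK setI_eq0 subsetD andbC.
  by rewrite -!andbA; congr (_ && _); rewrite andbC.
(* By symmetry [q] is constant on W, and its sum over W counts the samples that meet W. *)
have qE w : w \in W -> #|W|%:R * q w = #|[set A in draws D t | A :&: W != set0]|%:R.
  move=> wW; rewrite -sum_card_setI_inv mulr_natl -sumr_const.
  by apply: eq_bigr => v vW; apply: sum_card_setI_inv_tperm.
rewrite hit mulr_sumr.
rewrite (eq_bigr (fun w => #|W|%:R * (g w * q w))) => [|w wW]; last first.
  by rewrite -(qE w wW) mulrAC mulrA.
rewrite -mulr_sumr ler_wpM2l // /q.
under eq_bigr do rewrite mulr_sumr.
rewrite (exchange_big_dep (mem (draws D t))) /=; last by move=> w A _ /andP[].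
apply: ler_sum => A AD.
rewrite (eq_bigl (fun w => w \in A :&: W)) => [|w]; last by rewrite in_setI AD andbC.
have [->|AW] := eqVneq (A :&: W) set0; first by rewrite big_set0 G0.
apply: (@le_trans _ _ (\sum_(w in A :&: W) G A / #|A :&: W|%:R)).
  by apply: ler_sum => w wAW; rewrite ler_wpM2r ?invr_ge0 // gG.
by rewrite sumr_const -[leLHS]mulr_natr divfK // pnatr_eq0 cards_eq0.
Qed.

(** * Gains of the objective *)

Lemma spd_unitmx (R : realType) m (P : 'M[R]_m) : spd P -> P \in unitmx.
Proof.
move=> [_ Ppos]; rewrite -row_free_unit; apply: inj_row_free => v vP.
apply/eqP; apply: contraT => v0; have := Ppos v^T.
by rewrite trmxK vP mul0mx mxE ltxx -trmx0 (inj_eq trmx_inj) => /(_ v0).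
Qed.

Lemma spd_invmx (R : realType) m (P : 'M[R]_m) : spd P -> spd (invmx P).
Proof.
move=> Pspd; have uP := spd_unitmx Pspd; case: Pspd => [Psym Ppos].
have sym : (invmx P)^T = invmx P by rewrite trmx_inv Psym.
split=> // x x0; have := Ppos (invmx P *m x).
rewrite trmx_mul sym -!mulmxA mulKVmx // mulmxA; apply.
by apply: contra_neq x0 => Mx; rewrite -(mulKVmx uP x) Mx mulmx0.
Qed.

Lemma dotmx_ge0 (R : realType) m (x : 'cV[R]_m) : 0 <= (x^T *m x) 0 0.
Proof. by rewrite mxE sumr_ge0 // => i _; rewrite mxE -expr2 sqr_ge0. Qed.

Lemma dotmx_eq0 (R : realType) m (x : 'cV[R]_m) : (x^T *m x) 0 0 = 0 -> x = 0.
Proof.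
rewrite mxE => /eqP; rewrite psumr_eq0 => [/allP x0|i _]; last first.
  by rewrite mxE -expr2 sqr_ge0.
apply/matrixP => i j; rewrite (ord1 j) mxE; have := x0 i (mem_index_enum i).
by rewrite mxE mulf_eq0 orbb => /eqP.
Qed.

Lemma spd_rank1_update (R : realType) m (F : 'M[R]_m) (h : 'cV[R]_m) (a : R) :
  spd F -> 0 <= a -> spd (F + a *: (h *m h^T)).
Proof.
move=> [Fsym Fpos] a0; split=> [|x x0].
  by rewrite linearD linearZ /= trmx_mul trmxK Fsym.
rewrite mulmxDr mulmxDl mxE ltr_pwDl ?Fpos //.
rewrite -scalemxAr -scalemxAl mxE mulr_ge0 // !mulmxA -(mulmxA (x^T *m h)).
by rewrite -[x^T *m h]trmxK [X in X^T *m _]trmx_mul trmxK dotmx_ge0.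
Qed.

Lemma spd_fisher (R : realType) m n (P : 'M[R]_m) (h : 'I_n -> 'cV[R]_m)
    (var : 'I_n -> R) (S : {set 'I_n}) :
  spd P -> (forall i, 0 < var i) -> spd (fisher P h var S).
Proof.
move=> Pspd var0; rewrite /fisher; elim/big_rec: _ => [|i F _ Fspd].
  by rewrite addr0; apply: spd_invmx.
by rewrite addrCA addrC; apply: spd_rank1_update => //; rewrite invr_ge0 ltW.
Qed.

Lemma invmx_eq (R : realType) m (A B : 'M[R]_m) : A *m B = 1%:M -> invmx A = B.
Proof. by move=> AB; have [uA _] := mulmx1_unit AB; rewrite -[B](mulKmx uA) AB mulmx1. Qed.

(** Multiplying out, [HMH] makes every term other than the identity a multiple of [h *m h^T *m M],
    and the coefficients cancel. *)
Lemma sherman_morrison (R : realType) m (F : 'M[R]_m) (h : 'cV[R]_m) (v : R) :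
  spd F -> 0 < v ->
  invmx (F + v^-1 *: (h *m h^T))
    = invmx F - (v + (h^T *m invmx F *m h) 0 0)^-1 *: (invmx F *m h *m h^T *m invmx F).
Proof.
move=> Fspd v0; have uF := spd_unitmx Fspd.
set M := invmx F; set q := (_ *m _ *m h) 0 0.
have q0 : 0 <= q.
  have [h0|h0] := eqVneq h 0; first by rewrite /q h0 mulmx0 mxE.
  by apply/ltW; case: (spd_invmx Fspd) => _; apply.
apply: invmx_eq.
have HMH : h *m h^T *m M *m h *m h^T = q *: (h *m h^T).
  have hMh : h^T *m M *m h = q%:M by rewrite [LHS]mx11_scalar.
  by rewrite -(mulmxA h) -(mulmxA h) hMh mul_mx_scalar scalemxAl.
rewrite mulmxDl !mulmxBr -!scalemxAl -!scalemxAr !mulmxA mulmxV // mul1mx HMH.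
rewrite -!scalemxAl !scalerA -addrA -[RHS]addr0; congr (_ + _).
rewrite -!scaleNr -!scalerDl.
rewrite [X in X *: _](_ : _ = 0) ?scale0r //.
by rewrite /GRing.scale /=; field; rewrite !gt_eqF // ltr_wpDr.
Qed.

Section Objective.

Variables (R : realType) (m n : nat) (P : 'M[R]_m) (h : 'I_n -> 'cV[R]_m).
Variable var : 'I_n -> R.
Hypotheses (Pspd : spd P) (var_gt0 : forall i, 0 < var i).

Let f := objective P h var.
Let M S := invmx (fisher P h var S).

(** This is the invariant of the algorithm: the matrix it stores stays the inverse of the Fisher
    matrix of the current selection. *)
Lemma invmx_fisherU1 (S : {set 'I_n}) (i : 'I_n) : i \notin S ->
  M (i |: S) = value (update (M S) (h i) (var i)).
Proof.
move=> iS; rewrite updateE -sherman_morrison //; last exact: spd_fisher.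
by rewrite /M /fisher big_setU1 //= addrCA addrC.
Qed.

(** The trace of the rank-one correction is computed by cyclicity. Hence the scan for the largest
    score finds the largest gain. *)
Lemma marginal_objective (S : {set 'I_n}) (i : 'I_n) : i \notin S ->
  marginal f i S = value (score (M S) (h i) (var i)).
Proof.
move=> iS; rewrite /marginal /f /objective -/(M _) -/(M _) invmx_fisherU1 //.
rewrite updateE scoreE !linearB /= linearZ /=.
rewrite -[_ *m (h i)^T *m _]mulmxA mxtrace_mulC trace_mx11 !mulmxA; ring.
Qed.

Lemma fisher_quad_ge0 (S : {set 'I_n}) (x : 'cV[R]_m) : 0 <= (x^T *m M S *m x) 0 0.
Proof.
have [->|x0] := eqVneq x 0; first by rewrite mulmx0 mxE.
by apply/ltW; case: (spd_invmx (spd_fisher h S Pspd var_gt0)) => _; apply.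
Qed.

Lemma score_numE (S : {set 'I_n}) (x : 'cV[R]_m) :
  x^T *m (M S *m M S) *m x = (M S *m x)^T *m (M S *m x).
Proof.
have [sym _] := spd_invmx (spd_fisher h S Pspd var_gt0).
by rewrite trmx_mul sym !mulmxA.
Qed.

Lemma marginal_objective_ge0 (S : {set 'I_n}) (i : 'I_n) : 0 <= marginal f i S.
Proof.
have [iS|iS] := boolP (i \in S); first by rewrite /marginal (setUidPr _) ?sub1set // subrr.
rewrite marginal_objective // scoreE score_numE divr_ge0 ?dotmx_ge0 //.
by rewrite addr_ge0 ?fisher_quad_ge0 // ltW.
Qed.

(* A zero gain forces [h i = 0], since the inverse of [F_S] is invertible. *)
Lemma marginal_objective_eq0 (S T : {set 'I_n}) (i : 'I_n) :
  i \notin S -> i \notin T -> marginal f i S = 0 -> marginal f i T = 0.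
Proof.
move=> iS iT; rewrite (marginal_objective iS) scoreE score_numE => /eqP.
rewrite mulf_eq0 invr_eq0 (@gt_eqF _ _ (_ + _)) ?orbF; last first.
  by rewrite ltr_wpDr ?fisher_quad_ge0.
move=> /eqP/dotmx_eq0 Mh.
have uF := spd_unitmx (spd_fisher h S Pspd var_gt0).
have h0 : h i = 0 by rewrite -(mulKVmx uF (h i)) Mh mulmx0.
by rewrite (marginal_objective iT) scoreE h0 !mulmx0 mxE mul0r.
Qed.

Lemma objective_set0 : f set0 = 0.
Proof. by rewrite /f /objective /fisher big_set0 addr0 invmxK subrr linear0. Qed.

End Objective.

(** * Expected value of the greedy selection *)

Lemma marginal_le_curvature (R : realType) n (f : {set 'I_n} -> R) (S T : {set 'I_n})
    (i : 'I_n) :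
  (forall (A : {set 'I_n}) j, 0 <= marginal f j A) ->
  (marginal f i S = 0 -> marginal f i T = 0) ->
  S \subset T -> i \notin T ->
  marginal f i T <= Num.max (max_curvature f) 1 * marginal f i S.
Proof.
move=> f_ge0 f0 ST iT; set c := Num.max _ _.
have [fS0|fS0] := eqVneq (marginal f i S) 0; first by rewrite fS0 mulr0 f0.
have fS_gt0 : 0 < marginal f i S by rewrite lt_def fS0 f_ge0.
(* The maximum curvature ranges over [l >= 1], so [T = S] is left to the 1 in the maximum. *)
have [TS|/card_gt0P[j jTS]] := posnP #|T :\: S|.
  have -> : T = S.
    by apply/eqP; rewrite eqEsubset ST andbT -setD_eq0 -cards_eq0 TS.
  by rewrite ler_peMl ?f_ge0 // le_max lexx orbT.
rewrite -ler_pdivrMr // le_max; apply/orP; left.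
have l_lt_n : (#|T :\: S| < n)%N.
  rewrite -[n in (_ < n)%N]card_ord -cardsT; apply: proper_card.
  apply/properP; split; first exact: subsetT.
  by exists i; rewrite ?inE // (negbTE iT) andbF.
have l_gt0 : (0 < #|T :\: S|)%N by apply/card_gt0P; exists j.
apply: (@le_trans _ _ (curvature f #|T :\: S|)).
  rewrite /curvature.
  have dom : (S, T, i) \in curvature_dom n #|T :\: S| by rewrite inE ST iT eqxx.
  exact: (le_bigmax_cond 0 (fun x : {set 'I_n} * {set 'I_n} * 'I_n =>
    let: (S0, T0, i0) := x in marginal f i0 T0 / marginal f i0 S0) dom).
rewrite /max_curvature; apply: (le_bigmax_seq 0 _ xpredT (curvature f)) => //.
by rewrite mem_index_iota l_gt0.
Qed.

(** The elements of W are added one at a time, and each gain is compared through the curvature with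
    the gain of the same element at S. *)
Lemma gain_le_sum_marginal (R : realType) n (f : {set 'I_n} -> R) (S W : {set 'I_n}) :
  (forall (A : {set 'I_n}) j, 0 <= marginal f j A) ->
  (forall (A B : {set 'I_n}) j, j \notin A -> j \notin B -> marginal f j A = 0 -> marginal f j B = 0) ->
  [disjoint S & W] ->
  f (S :|: W) - f S <= Num.max (max_curvature f) 1 * \sum_(i in W) marginal f i S.
Proof.
move=> f_ge0 f0; rewrite disjoint_sym disjoint_subset => /subsetP dis.
rewrite -[\sum_(i in W) _]big_enum /= -[W in f (_ :|: W)](set_enum W).
have: {in enum W, forall i, i \notin S} by move=> i; rewrite mem_enum => /dis.
elim: (enum W) (enum_uniq W) => [|i w IHw] /= => [_ _|/andP[iw w_uniq] wS].
  by rewrite set_nil setU0 subrr big_nil mulr0.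
have iS : i \notin S by apply: wS; rewrite mem_head.
have {}IHw : f (S :|: [set:: w]) - f S
    <= Num.max (max_curvature f) 1 * \sum_(j <- w) marginal f j S.
  by apply: IHw => // j jw; apply: wS; rewrite inE jw orbT.
rewrite set_cons setUCA big_cons mulrDr.
have := @marginal_le_curvature _ _ f S (S :|: [set:: w]) i f_ge0.
have iSw : i \notin S :|: [set:: w] by rewrite !inE negb_or iS.
move=> /(_ (f0 _ _ _ iS iSw) (subsetUl _ _) iSw); rewrite {1}/marginal; lra.
Qed.

Lemma marginal_ge0_homo (R : realType) n (f : {set 'I_n} -> R) (S T : {set 'I_n}) :
  (forall (A : {set 'I_n}) j, 0 <= marginal f j A) -> S \subset T -> f S <= f T.
Proof.
move=> f_ge0 /setUidPr <-; rewrite -(set_enum T).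
elim: (enum T) => [|i w IHw]; first by rewrite set_nil setU0.
rewrite set_cons setUCA; apply: le_trans IHw _.
by have := f_ge0 (S :|: [set:: w]) i; rewrite /marginal subr_ge0.
Qed.

Lemma greedy_step_cases (R : realType) m n (P : 'M[R]_m) (h : 'I_n -> 'cV[R]_m)
    (var : 'I_n -> R) (ord : {set 'I_n} -> {set 'I_n} -> seq 'I_n)
    (S A : {set 'I_n}) :
  spd P -> (forall i, 0 < var i) -> perm_eq (ord S A) (enum A) -> A \subset ~: S ->
  exists2 T : {set 'I_n},
    value (greedy_step h var ord (S, invmx (fisher P h var S)) A)
      = (T, invmx (fisher P h var T)) &
    objective P h var S <= objective P h var T /\
    {in A, forall j, marginal (objective P h var) j S
                       <= objective P h var T - objective P h var S}.
Proof.
move=> Pspd var0 ordA /subsetP AS.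
have memA j : (j \in ord S A) = (j \in A) by rewrite (perm_mem ordA) mem_enum.
have fge0 := marginal_objective_ge0 h Pspd var0.
have [A0|ord0] := eqVneq (ord S A) [::].
  exists S; first by rewrite /greedy_step /draw /= A0.
  by split=> // j; rewrite -memA A0.
have [i scan_i [iA imax]] :=
  scanP (fun j => score (invmx (fisher P h var S)) (h j) (var j)) ord0.
have iS : i \notin S by have := AS i; rewrite -memA inE => /(_ iA).
exists (i |: S).
  rewrite (invmx_fisherU1 _ Pspd var0) //; set N := invmx _ in scan_i *.
  transitivity (value (if value (scan (fun j => score N (h j) (var j)) (ord S A)) is Some b
    then do T <- op (b.1 |: S); do N' <- update N (h b.1) (var b.1); ret (T, N')
    else ret (S, N))); first by [].
  by rewrite scan_i.
split=> [|j jA]; first by rewrite -subr_ge0; apply: fge0.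
have jS : j \notin S by have := AS j jA; rewrite inE.
rewrite -/(marginal (objective P h var) i S).
by rewrite !(marginal_objective _ Pspd var0) // imax // memA.
Qed.

Section Expectation.

Variables (R : realType) (m n K : nat) (P : 'M[R]_m) (h : 'I_n -> 'cV[R]_m).
Variables (var : 'I_n -> R) (ord : {set 'I_n} -> {set 'I_n} -> seq 'I_n).
Variables (s : R) (O : {set 'I_n}).
Hypotheses (Pspd : spd P) (var_gt0 : forall i, 0 < var i).
Hypothesis (ordP : forall S A, perm_eq (ord S A) (enum A)).
Hypotheses (s_bound : 0 < s <= n%:R) (cardO : #|O| = K).

Let f := objective P h var.
Let c := Num.max (max_curvature f) 1.
Let state_of (S : {set 'I_n}) : state R m n := (S, invmx (fisher P h var S)).
Let x := expR (- (beta_exp n s * s / n%:R)).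

Hypothesis (x_le1 : x <= 1).

Let next S A := (value (greedy_step h var ord (state_of S) A)).1.

Let step_cases (S A : {set 'I_n}) : A \subset ~: S ->
  [/\ value (greedy_step h var ord (state_of S) A) = state_of (next S A),
      f S <= f (next S A) &
      {in A, forall j, marginal f j S <= f (next S A) - f S}].
Proof.
move=> AS.
have [T stepE [fST fT]] := greedy_step_cases h Pspd var_gt0 (ordP S A) AS.
by rewrite /next stepE.
Qed.

Lemma mean_gain_ge (S : {set 'I_n}) :
  (1 - x ^+ K) * (f O - f S)
    <= K%:R * c * (#|samples s S|%:R^-1 * \sum_(A in samples s S) (f (next S A) - f S)).
Proof.
have s_gt0 : 0 < s by case/andP: s_bound.
set t := minn `|Num.ceil s|%N #|~: S|.
have c0 : 0 < c by rewrite lt_max ltr01 orbT.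
have sub (A : {set 'I_n}) : A \in samples s S -> A \subset ~: S by rewrite inE => /andP[].
have fge0 := marginal_objective_ge0 h Pspd var_gt0.
set W := O :\: S; set G := \sum_(A in samples s S) _.
have G0 : 0 <= G.
  by apply: sumr_ge0 => A /sub/step_cases[_ fS _]; rewrite subr_ge0.
have WS : W \subset ~: S by rewrite /W setDE subsetIr.
have WK : (#|W| <= K)%N by rewrite -cardO subset_leq_card // subsetDl.
have Wsum : 0 <= \sum_(w in W) marginal f w S by apply: sumr_ge0 => w _; apply: fge0.
have x01 : 0 <= x <= 1 by rewrite expR_ge0.
have gap : f O - f S <= c * \sum_(w in W) marginal f w S.
  apply: (@le_trans _ _ (f (S :|: W) - f S)).
    rewrite lerB // (marginal_ge0_homo fge0) // /W.
    by apply/subsetP => o oO; rewrite !inE oO andbT orbN.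
  apply: gain_le_sum_marginal => //; first exact: marginal_objective_eq0.
  by rewrite -setI_eq0; apply/eqP/setP => o; rewrite !inE; case: (o \in S).
have C0 : 0 < #|samples s S|%:R :> R by rewrite ltr0n card_samples_gt0.
have CE : #|samples s S| = 'C(#|~: S|, t) by rewrite -cards_draws.
have main : (1 - x ^+ K) * \sum_(w in W) marginal f w S <= K%:R * (#|samples s S|%:R^-1 * G).
  have [r0|r0] := posnP #|W|.
    have /eqP W0 : W == set0 by rewrite -cards_eq0 r0.
    by rewrite W0 big_set0 mulr0 !mulr_ge0 // invr_ge0.
  have NB : (#|~: S| <= n)%N by rewrite -[n in (_ <= n)%N]card_ord max_card.
  have := bin_subn_le_expR_beta NB (subset_leq_card WS) s_bound (natr_ceil_bound s_gt0).
  rewrite -/t -/x -CE => miss.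
  have hit : (#|samples s S|%:R - 'C(#|~: S| - #|W|, t)%:R)
      * \sum_(w in W) marginal f w S <= #|W|%:R * G.
    rewrite CE; apply: sum_draws_ge WS _ _ => A /sub/step_cases[_ fS fA].
      by rewrite subr_ge0.
    by move=> w; rewrite inE => /andP[wA _]; apply: fA.
  have ratio := onem_expr_ratio x01 WK.
  have r0' : 0 < #|W|%:R :> R by rewrite ltr0n.
  rewrite mulrCA ler_pdivlMl // -(ler_pM2l r0').
  set gW := \sum_(w in W) _ in Wsum hit *.
  (* [ratio] trades [#|W| * (1 - x ^+ K)] for [K * (1 - x ^+ #|W|)]; [miss] then bounds the number
     of samples meeting W from below, as [hit] requires. *)
  apply: (@le_trans _ _ (K%:R * (1 - x ^+ #|W|) * (#|samples s S|%:R * gW))).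
    rewrite (_ : #|W|%:R * _ = #|W|%:R * (1 - x ^+ K) * (#|samples s S|%:R * gW)).
      by apply: ler_wpM2r => //; apply: mulr_ge0; rewrite // ltW.
    by ring.
  rewrite -mulrA [leRHS]mulrCA ler_wpM2l // (le_trans _ hit) // mulrA.
  by apply: ler_wpM2r => //; lra.
have x1K : 0 <= 1 - x ^+ K by rewrite subr_ge0 exprn_ile1 //; case/andP: x01.
apply: le_trans (ler_wpM2l x1K gap) _.
rewrite mulrCA [K%:R * c]mulrC -mulrA.
by apply: ler_wpM2l => //; apply: ltW.
Qed.

(** The run starts from an arbitrary selection, which allows an induction on the number of remaining
    steps by conditioning on the first sample. *)
Let expect k S :=
  \sum_(As : k.-tuple {set 'I_n}) samples_prob h var ord s (state_of S) As
     * f (value (tfold (greedy_step h var ord) (state_of S) As)).1.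

Lemma expectS k (S : {set 'I_n}) :
  expect k.+1 S = #|samples s S|%:R^-1 * \sum_(A in samples s S) expect k (next S A).
Proof.
rewrite /expect.
pose F (y : {set 'I_n} * k.-tuple {set 'I_n}) := [tuple of y.1 :: y.2].
rewrite (reindex F) /=; last first.
  exists (fun As => (thead As, [tuple of behead As])) => [[A As] _|As _].
    by rewrite /F /=; congr (_, _); apply: val_inj.
  by rewrite /F /= [RHS]tuple_eta; apply: val_inj.
rewrite -(pair_bigA _ (fun A (As : k.-tuple _) =>
  samples_prob h var ord s (state_of S) (A :: As) *
  f (value (tfold (greedy_step h var ord) (state_of S) (A :: As))).1)) /=.
rewrite mulr_sumr [RHS]big_mkcond; apply: eq_bigr => A _.
case: ifP => [|_]; last by rewrite big1 // => As _; rewrite !mul0r.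
rewrite inE => /andP[/step_cases[stepE _ _] _].
by rewrite mulr_sumr; apply: eq_bigr => As _; rewrite -stepE mulrA.
Qed.

Lemma expect_ge k (S : {set 'I_n}) : (0 < K)%N ->
  f O - (1 - (1 - x ^+ K) / (K%:R * c)) ^+ k * (f O - f S) <= expect k S.
Proof.
move=> K0; set a := _ / _.
have c1 : 1 <= c by rewrite le_max lexx orbT.
have K1 : 1 <= K%:R :> R by rewrite ler1n.
have Kc0 : 0 < K%:R * c by rewrite mulr_gt0 // ?ltr0n // (lt_le_trans _ c1).
have xK : 0 <= x ^+ K by rewrite exprn_ge0 // expR_ge0.
have a1 : 0 <= 1 - a.
  rewrite subr_ge0 ler_pdivrMr // mul1r; nra.
elim: k S => [|k IHk] S.
  rewrite /expect expr0 mul1r opprD opprK addrA subrr add0r.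
  by rewrite (big_pred1 [tuple]) /= ?mul1r // => As; rewrite (tuple0 As).
have C0 : 0 < #|samples s S|%:R :> R by rewrite ltr0n card_samples_gt0.
rewrite expectS.
apply: (@le_trans _ _ (#|samples s S|%:R^-1 * \sum_(A in samples s S)
  (f O - (1 - a) ^+ k * (f O - f (next S A))))); last first.
  by apply: ler_wpM2l; [rewrite invr_ge0 ltW|apply: ler_sum => A _; apply: IHk].
(* The bound from the induction hypothesis is affine in [f (next S A)], so its average over the
   samples involves only the mean gain. *)
rewrite (eq_bigr (fun A => (f O - (1 - a) ^+ k * (f O - f S))
   + (1 - a) ^+ k * (f (next S A) - f S))) => [|A _]; last by ring.
rewrite big_split /= sumr_const -mulr_sumr [leRHS]mulrDr -[(_ - _) *+ _]mulr_natl.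
rewrite mulKf ?gt_eqF // mulrCA.
have := mean_gain_ge S; rewrite -ler_pdivrMl //.
set E := _^-1 * \sum_(A in _) _ => gain.
have {}gain : a * (f O - f S) <= E by apply: le_trans gain; rewrite /a mulrA [_^-1 * _]mulrC.
have := ler_wpM2l (exprn_ge0 k a1) gain; rewrite exprSr; lra.
Qed.

End Expectation.

Lemma greedy_expectation_ge (R : realType) (m n K : nat) (P : 'M[R]_m)
    (h : 'I_n -> 'cV[R]_m) (var : 'I_n -> R)
    (ord : {set 'I_n} -> {set 'I_n} -> seq 'I_n) (eps : R) (O : {set 'I_n}) :
  spd P -> (forall i, 0 < var i) -> (forall S A, perm_eq (ord S A) (enum A)) ->
  expR (- K%:R) <= eps < 1 -> #|O| = K ->
  (1 - expR (- (Num.max (max_curvature (objective P h var)) 1)^-1)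
     - eps `^ beta_exp n (sample_param n K eps)
       / Num.max (max_curvature (objective P h var)) 1) * objective P h var O
    <= greedy_expectation P h var ord (sample_param n K eps) K (objective P h var).
Proof.
move=> Pspd var0 ordP /andP[epsK eps1] cardO.
set s := sample_param n K eps; set c := Num.max _ 1.
have eps0 : 0 < eps by apply: lt_le_trans epsK; apply: expR_gt0.
have K0 : (0 < K)%N.
  by rewrite lt0n; apply: contraTneq epsK => ->; rewrite oppr0 expR0 -ltNge.
have Kn : (K <= n)%N by rewrite -cardO -[n in (_ <= n)%N]card_ord max_card.
have KR : 0 < K%:R :> R by rewrite ltr0n.
have nR : 0 < n%:R :> R by rewrite ltr0n (leq_trans K0).
have lnE : ln eps^-1 = - ln eps by rewrite lnV.
have l0 : 0 < ln eps^-1 by rewrite ln_gt0 // invf_gt1.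
have lK : ln eps^-1 <= K%:R.
  by rewrite lnE lerNl -(expRK (- K%:R)) ler_ln ?posrE ?expR_gt0.
have s_bound : 0 < s <= n%:R.
  rewrite /s /sample_param mulr_gt0 ?divr_gt0 //=.
  by rewrite mulrAC ler_pdivrMr // ler_wpM2l // ltW.
set f := objective P h var; set b := beta_exp n s.
have b1 : 1 <= b.
  by rewrite /b /beta_exp lerDl; case: ifP => // _; rewrite le_max lexx.
pose x := expR (- (b * s / n%:R)).
(* Since [s = n / K * ln (1 / eps)], the exponent [K * b * s / n] is [b * ln (1 / eps)]. *)
have xK : x ^+ K = eps `^ b.
  rewrite /x -expRM_natl /powR gt_eqF //; congr expR.
  by rewrite /s /sample_param lnE; field; rewrite !gt_eqF.
have x1 : x <= 1.
  rewrite /x expR_le1 oppr_le0 divr_ge0 // mulr_ge0 ?(le_trans ler01 b1) //.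
  by apply/ltW; case/andP: s_bound.
have := expect_ge h Pspd var0 ordP s_bound cardO x1 K set0 K0.
rewrite -/c (objective_set0 P h var) subr0 -/x xK -/f => low.
have st0 : init_state n P = (set0, invmx (fisher P h var set0)).
  by rewrite /fisher big_set0 addr0 invmxK.
rewrite /greedy_expectation /run_prob /greedy_set /greedy st0.
apply: le_trans low.
have fO : 0 <= f O.
  rewrite -(objective_set0 P h var); apply: marginal_ge0_homo; last exact: sub0set.
  exact: marginal_objective_ge0.
rewrite -[X in _ <= X - _]mul1r -mulrBl; apply: ler_wpM2r => //.
have c1 : 1 <= c by rewrite le_max lexx orbT.
have c0 : 0 < c by apply: lt_le_trans c1.
have p01 : 0 <= eps `^ b <= 1.
  by rewrite powR_ge0 /= -xK exprn_ile1 ?expR_ge0.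
have := expR_onem_div_le p01 c1.
have : (1 - (1 - eps `^ b) / (K%:R * c)) ^+ K <= expR (- ((1 - eps `^ b) / c)).
  rewrite (_ : - (_ / c) = K%:R * (- ((1 - eps `^ b) / (K%:R * c)))); last by field; rewrite !gt_eqF.
  rewrite expRM_natl lerXn2r ?nnegrE ?expR_ge0 //; last exact: expR_ge1Dx.
  rewrite subr_ge0 ler_pdivrMr ?mulr_gt0 // mul1r.
  have : 1 <= K%:R :> R by rewrite ler1n.
  by case/andP: p01; nra.
lra.
Qed.

(** * Operation count *)

Lemma cost_bind A B (c : timed A) (k : A -> timed B) :
  cost (bind c k) = (cost c + cost (k (value c)))%N.
Proof. by []. Qed.

Lemma cost_tfold_const A B (step : B -> A -> timed B) (C : nat) (r : seq A) (b : B) :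
  (forall b a, cost (step b a) = C) -> cost (tfold step b r) = (size r * C)%N.
Proof.
move=> stepC; elim: r b => // a r IHr b.
by rewrite [tfold _ _ _]/= cost_bind IHr stepC mulSn.
Qed.

Lemma cost_dot (R : realType) m (x y : 'I_m -> R) : cost (dot x y) = (2 * m)%N.
Proof. by rewrite /dot (@cost_tfold_const _ _ _ 2) // size_enum_ord mulnC. Qed.

Lemma cost_matvec (R : realType) m (M : 'M[R]_m) (x : 'cV[R]_m) :
  cost (matvec M x) = (2 * m ^ 2)%N.
Proof.
rewrite /matvec /tcol /=; under eq_bigr do rewrite cost_dot.
by rewrite sum_nat_const card_ord mulnCA mulnn.
Qed.

Lemma cost_score (R : realType) m (M : 'M[R]_m) (h : 'cV[R]_m) (v : R) :
  cost (score M h v) = (4 * m ^ 2 + 4 * m + 2)%N.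
Proof.
by rewrite /score !cost_bind !cost_matvec !cost_dot /=; lia.
Qed.

Lemma cost_update (R : realType) m (M : 'M[R]_m) (h : 'cV[R]_m) (v : R) :
  cost (update M h v) = (7 * m ^ 2 + 2 * m + 1)%N.
Proof.
rewrite /update !cost_bind !cost_matvec !cost_dot /=.
under eq_bigr do rewrite sum_nat_const card_ord.
rewrite sum_nat_const card_ord; lia.
Qed.

(** The extra unit per element pays for the comparison, which the first element does not need. *)
Lemma cost_scan_le (R : realType) n (g : 'I_n -> timed R) (C : nat) (r : seq 'I_n) :
  (forall j, cost (g j) = C) -> (cost (scan g r) <= size r * C.+1)%N.
Proof.
move=> gC; rewrite /scan; elim: r None => // j r IHr b.
rewrite [tfold _ _ _]/= cost_bind mulSn leq_add // {IHr} /scan_step cost_bind gC.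
by case: b => [b|] /=; lia.
Qed.

Lemma cost_greedy_step_le (R : realType) m n (h : 'I_n -> 'cV[R]_m) (var : 'I_n -> R)
    (ord : {set 'I_n} -> {set 'I_n} -> seq 'I_n) (st : state R m n) (A : {set 'I_n}) :
  (0 < m)%N -> perm_eq (ord st.1 A) (enum A) ->
  (cost (greedy_step h var ord st A) <= (#|A| + 1) * (12 * m ^ 2))%N.
Proof.
move=> m0 /perm_size ordA; have {}ordA : size (ord st.1 A) = #|A| by rewrite ordA cardE.
have := @cost_scan_le _ _ (fun j => score st.2 (h j) (var j)) _ (ord st.1 A)
  (fun j => cost_score st.2 (h j) (var j)).
rewrite /greedy_step !cost_bind [value (draw _)]/= [cost (draw _)]/= ordA => scanC.
have m_le : (m <= m ^ 2)%N by rewrite -mulnn leq_pmulr.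
(* Drawing, scoring and comparing cost at most [4 m^2 + 4 m + 4] per index, insertion and update
   [7 m^2 + 2 m + 2] per step; both are at most [12 m^2] because [1 <= m <= m^2]. *)
have := leq_mul (leqnn #|A|) m_le; have := leq_mul (leqnn #|A|) (leq_trans m0 m_le).
case: (value _) => [b|]; first rewrite 2!cost_bind cost_update.
  by rewrite [cost (op _)]/= [cost (ret _)]/=; lia.
by rewrite [cost (ret _)]/=; lia.
Qed.

Lemma cost_greedy_le (R : realType) m n (h : 'I_n -> 'cV[R]_m) (var : 'I_n -> R)
    (ord : {set 'I_n} -> {set 'I_n} -> seq 'I_n) (s : R) (st : state R m n)
    (As : seq {set 'I_n}) :
  (0 < m)%N -> (forall S A, perm_eq (ord S A) (enum A)) -> 0 < s ->
  0 < samples_prob h var ord s st As ->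
  (cost (tfold (greedy_step h var ord) st As))%:R
    <= (size As)%:R * ((s + 2) * (12 * m%:R ^+ 2)).
Proof.
move=> m0 ordP s0; elim: As st => [|A As IHAs] st; first by rewrite mul0r.
rewrite [samples_prob _ _ _ _ _ _]/= [tfold _ _ _]/=.
case: ifP => [|_]; last by rewrite mul0r ltxx.
rewrite inE => /andP[_ /eqP cardA] probA.
(* Positive probability passes to the rest of the run. It also forces each sample to have fewer than
   [s + 1] elements, whence the factor [s + 2]. *)
have prob_gt0 : 0 < samples_prob h var ord s (value (greedy_step h var ord st A)) As.
  rewrite lt_def samples_prob_ge0 andbT; apply: contraTneq probA => ->.
  by rewrite mulr0 ltxx.
rewrite cost_bind natrD [size _]/= -natr1 mulrDl mul1r addrC lerD ?IHAs //.
have := cost_greedy_step_le h var m0 (ordP st.1 A).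
rewrite -(ler_nat R) => /le_trans; apply.
rewrite natrM natrM natrX natrD ler_wpM2r ?mulr_ge0 ?exprn_ge0 //.
have : #|A|%:R <= `|Num.ceil s|%N%:R :> R by rewrite ler_nat cardA geq_minl.
have /andP[_] := natr_ceil_bound s0; lra.
Qed.

(** Since [K * s = n * ln (1 / eps)], the sampling cost has the desired order. The K updates cost of
    order [K * m^2] whatever s is; the lower bound [s0] absorbs them through [2 <= 2 * s / s0], so
    the constant depends on [s0] alone. *)
Lemma cost_greedy_bound (R : realType) (s0 : R) : 0 < s0 ->
  exists C : R,
  forall (m n K : nat) (P : 'M[R]_m) (h : 'I_n -> 'cV[R]_m)
    (var : 'I_n -> R) (ord : {set 'I_n} -> {set 'I_n} -> seq 'I_n) (eps : R),
    (0 < m)%N -> (forall S A, perm_eq (ord S A) (enum A)) ->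
    s0 <= sample_param n K eps ->
    forall As : K.-tuple {set 'I_n},
      0 < run_prob P h var ord (sample_param n K eps) As ->
      (cost (greedy P h var ord As))%:R <= C * (n%:R * m%:R ^+ 2 * ln (eps^-1)).
Proof.
move=> s00; exists ((1 + 2 / s0) * 12) => m n K P h var ord eps m0 ordP.
set s := sample_param n K eps => s0s As prob.
have s_gt0 : 0 < s by apply: lt_le_trans s0s.
apply: le_trans (cost_greedy_le m0 ordP s_gt0 prob) _.
have K0 : K%:R != 0 :> R.
  by apply: contraTneq s_gt0 => K0; rewrite /s /sample_param K0 invr0 mulr0 mul0r ltxx.
rewrite size_tuple.
have -> : (1 + 2 / s0) * 12 * (n%:R * m%:R ^+ 2 * ln eps^-1)
    = K%:R * ((s + s / s0 * 2) * (12 * m%:R ^+ 2)).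
  by rewrite /s /sample_param; field; rewrite K0 gt_eqF.
rewrite ler_wpM2l // ler_wpM2r ?mulr_ge0 ?exprn_ge0 // lerD2l.
by rewrite ler_peMl // ler_pdivlMr // mul1r.
Qed.

Theorem theorem2 (R : realType) :
  (forall (m n K : nat) (P : 'M[R]_m) (h : 'I_n -> 'cV[R]_m) (var : 'I_n -> R)
     (ord : {set 'I_n} -> {set 'I_n} -> seq 'I_n) (eps : R) (O : {set 'I_n}),
     spd P ->
     (forall i, 0 < var i) ->
     (forall S A, perm_eq (ord S A) (enum A)) ->
     expR (- K%:R) <= eps < 1 ->
     is_optimum (objective P h var) K O ->
     let s := sample_param n K eps in
     let c := Num.max (max_curvature (objective P h var)) 1 in
     (1 - expR (- c^-1) - eps `^ beta_exp n s / c) * objective P h var O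
       <= greedy_expectation P h var ord s K (objective P h var))
  /\
  (forall s0 : R, 0 < s0 ->
     exists C : R,
     forall (m n K : nat) (P : 'M[R]_m) (h : 'I_n -> 'cV[R]_m)
       (var : 'I_n -> R) (ord : {set 'I_n} -> {set 'I_n} -> seq 'I_n)
       (eps : R),
       (0 < m)%N ->
       (K <= n)%N ->
       spd P ->
       (forall i, 0 < var i) ->
       (forall S A, perm_eq (ord S A) (enum A)) ->
       expR (- K%:R) <= eps < 1 ->
       s0 <= sample_param n K eps ->
       forall As : K.-tuple {set 'I_n},
         0 < run_prob P h var ord (sample_param n K eps) As ->
         (cost (greedy P h var ord As))%:R
           <= C * (n%:R * m%:R ^+ 2 * ln (eps^-1))).
Proof.
split=> [m n K P h var ord eps O Pspd var0 ordP epsP [cardO _]|s0 s0_gt0].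
  exact: greedy_expectation_ge.
have [C costC] := cost_greedy_bound s0_gt0.
exists C => m n K P h var ord eps m0 _ _ _ ordP _ s0s As prob.
exact: costC.
Qed.
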